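(* Let $D$ be a subset of $\mathbb{R}$, $N$ a nonnegative integer, and $a_{\alpha,\beta}\in\mathbb{C}$ for $\alpha\in D$, $\beta=0,\dots,N$. Then the double series $$\sum_{\alpha\in D}\sum_{\beta=0}^{N}a_{\alpha,\beta}z^\alpha(\log z)^\beta$$ is absolutely convergent on some (nonempty) open subset of $\mathbb{C}^\times$ if and only if the series $$\sum_{\alpha\in D}\left(\sum_{\beta=0}^{N}a_{\alpha,\beta}(\log z)^\beta\right)z^\alpha$$ and the corresponding series of first and higher derivatives with respect to $z$, viewed as series whose terms are the expressions $\left(\sum_{\beta=0}^{N}a_{\alpha,\beta}(\log z)^\beta\right)z^\alpha$ and their derivatives with respect to $z$, are absolutely convergent on the same open subset.
   Context: $\mathbb{C}^\times=\mathbb{C}\setminus\{0\}$. For $z\in\mathbb{C}^\times$, $\log z=\log|z|+i\arg z$ with $0\le\arg z<2\pi$, and $z^\alpha=e^{\alpha\log z}$. Derivatives of the terms are computed by the usual rules $\frac{d}{dz}\log z=z^{-1}$, $\frac{d}{dz}z^\alpha=\alpha z^{\alpha-1}$ (also at points of the positive real axis). Absolute convergence on a set means absolute convergence at each point of it. The double series is regarded as a series indexed by pairs $(\alpha,\beta)$; in the second series each term indexed by $\alpha$ (the whole finite inner sum times $z^\alpha$) is a single term. *)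

(* Defs.v *)
From HB Require Import structures.
From mathcomp Require Import all_boot all_order all_algebra complex.
From mathcomp Require Import all_classical all_reals all_analysis.

Set Implicit Arguments.
Unset Strict Implicit.
Unset Printing Implicit Defensive.

Import Order.TTheory GRing.Theory Num.Theory.
Import numFieldNormedType.Exports.
Import ComplexField.Normc.

Local Open Scope classical_set_scope.
Local Open Scope complex_scope.
Local Open Scope ring_scope.

Section ComplexFunctions.
Variable R : realType.
Implicit Types (z : R[i]) (x : R).

Definition cexp z : R[i] :=
  (expR (complex.Re z) * cos (complex.Im z)) +i* (expR (complex.Re z) * sin (complex.Im z)).

(* The argument in [0, 2 pi); [carg_def] shows that this is the right value.
   At z = 0 the values of [carg], [clog] and [cpow] are meaningless. *)
Definition carg z : R :=
  if 0 <= complex.Im z then acos (complex.Re z / normc z) else pi *+ 2 - acos (complex.Re z / normc z).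

Definition clog z : R[i] := ln (normc z) +i* carg z.

Definition cpow z x : R[i] := cexp (x%:C * clog z).

Lemma carg_def z : z != 0 ->
  0 <= carg z < pi *+ 2 /\
  z = (normc z)%:C * (cos (carg z) +i* sin (carg z)).
Proof.
case: z => a b nz.
have n2 : normc (a +i* b) ^+ 2 = a ^+ 2 + b ^+ 2.
  by rewrite /normc sqr_sqrtr // addr_ge0 ?sqr_ge0.
have npos : 0 < normc (a +i* b).
  rewrite lt_neqAle /normc sqrtr_ge0 andbT eq_sym -/(normc (a +i* b)).
  by apply: contra nz => /eqP /eq0_normc ->.
set r := normc _ in n2 npos *.
have r0 : r != 0 by rewrite gt_eqF.
have ler : `|a / r| <= 1.
  rewrite normrM normfV (gtr0_norm npos) ler_pdivrMr // mul1r.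
  rewrite -(gtr0_norm npos) -ler_sqr ?nnegrE ?normr_ge0 //.
  by rewrite !real_normK ?num_real // n2 lerDl sqr_ge0.
have hB : -1 <= a / r <= 1 by rewrite -ler_norml.
have [/andP[t0 tpi] ct] := acos_def hB.
have st : r * sin (acos (a / r)) = `|b|.
  rewrite sin_acos // -(ger0_norm (ltW npos)) -sqrtr_sqr -sqrtrM ?sqr_ge0 //.
  rewrite mulrBr mulr1 sqrtr_sqr (gtr0_norm npos) expr_div_n mulrCA divff ?mulr1.
    by rewrite n2 addrAC subrr add0r sqrtr_sqr.
  by rewrite sqrf_eq0.
have pi0 : 0 < pi :> R by exact: pi_gt0.
rewrite /carg /= -/r; case: (leP 0 b) => b0.
  split; first by rewrite t0 (le_lt_trans tpi) // mulr2n ltrDl.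
  by rewrite /real_complex_def; simpc; rewrite ct st mulrCA divff // mulr1 ger0_norm.
have tgt : 0 < acos (a / r).
  rewrite lt_neqAle t0 andbT; apply: contraTneq b0 => t00.
  by move: st; rewrite -t00 sin0 mulr0 => /esym /eqP; rewrite normr_eq0 => /eqP ->; rewrite ltxx.
split.
  rewrite subr_ge0 gtrBl tgt andbT (le_trans tpi) // mulr2n lerDl; exact: ltW.
rewrite /real_complex_def; simpc.
have -> : pi *+ 2 - acos (a / r) = - acos (a / r) + pi *+ 2 by rewrite addrC.
have := @sinD2pi R; have := @cosD2pi R.
rewrite /= => -> ->; rewrite cosN sinN ct mulrN st mulrCA divff // mulr1.
by rewrite ltr0_norm // opprK.
Qed.

End ComplexFunctions.

(* Expressions in z built from log z and the powers z^x, so that derivatives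
   are given by the usual rules everywhere on C \ {0}, including at the points
   of the positive real axis, where [clog] is not continuous. *)
Section Expressions.
Variable R : realType.

Inductive expr : Type :=
  | EConst of R[i]
  | ELog
  | EPow of R
  | EAdd of expr & expr
  | EMul of expr & expr.

Fixpoint eeval (e : expr) (z : R[i]) : R[i] :=
  match e with
  | EConst c => c
  | ELog => clog z
  | EPow x => cpow z x
  | EAdd e1 e2 => eeval e1 z + eeval e2 z
  | EMul e1 e2 => eeval e1 z * eeval e2 z
  end.

Fixpoint ederiv (e : expr) : expr :=
  match e with
  | EConst _ => EConst 0
  | ELog => EPow (- 1)
  | EPow x => EMul (EConst x%:C) (EPow (x - 1))
  | EAdd e1 e2 => EAdd (ederiv e1) (ederiv e2)
  | EMul e1 e2 => EAdd (EMul (ederiv e1) e2) (EMul e1 (ederiv e2))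
  end.

Definition elogX (n : nat) : expr := iter n (EMul ELog) (EConst 1).

Definition eterm (N : nat) (c : 'I_N.+1 -> R[i]) (x : R) : expr :=
  EMul (\big[EAdd/EConst 0]_(b < N.+1) EMul (EConst (c b)) (elogX b)) (EPow x).

Lemma eeval_eterm N (c : 'I_N.+1 -> R[i]) (x : R) (z : R[i]) :
  eeval (eterm c x) z = (\sum_(b < N.+1) c b * clog z ^+ b) * cpow z x.
Proof.
rewrite /eterm /=; congr (_ * _).
rewrite (big_morph (eeval^~ z) (id1 := 0) (op1 := +%R)) //=.
apply: eq_bigr => b _; congr (_ * _).
by elim: (nat_of_ord b) => [|n IHn] //=; rewrite IHn exprS.
Qed.

Lemma cpowN1 (z : R[i]) : z != 0 -> cpow z (- 1) = z^-1.
Proof.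
move=> nz; have [_ zE] := carg_def nz.
have npos : 0 < normc z.
  rewrite lt_neqAle; apply/andP; split; last by case: (z) => ? ?; exact: sqrtr_ge0.
  by rewrite eq_sym; apply: contra nz => /eqP /eq0_normc ->.
apply: (mulIf nz); rewrite mulVf // {2}zE /cpow /cexp /clog /real_complex_def.
simpc; rewrite expRN lnK ?posrE // cosN sinN.
set n := normc z in npos *; set t := carg z.
have n0 : n != 0 by rewrite gt_eqF.
have e : n^-1 * cos t * (n * cos t) - n^-1 * - sin t * (n * sin t) = 1.
  rewrite mulrN mulNr opprK [X in X + _]mulrACA [X in _ + X]mulrACA mulVf // !mul1r.
  by rewrite -!expr2 cos2Dsin2.
have f : n^-1 * cos t * (n * sin t) + n^-1 * - sin t * (n * cos t) = 0.
  rewrite mulrN mulNr [X in X - _]mulrACA [X in _ - X]mulrACA.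
  by rewrite [sin t * _]mulrC subrr.
by rewrite e f.
Qed.

End Expressions.

Definition abs_convergent (R : realType) (I : choiceType) (D : set I)
    (f : I -> R[i]) : Prop :=
  summable D (fun i => (normc (f i))%:E).

(* Main.v *)
(* Since |z^x| = |z|^x, nearby points of modulus |z| give the same weight to the
   exponent x but distinct values of log z.  Given N+1 such points, Lagrange
   interpolation bounds each |a x b| |z|^x by the sums over b at these points, so
   the grouped series alone already yields the double series.  Conversely, the
   k-th derivative of the x-th term is bounded by a polynomial in |x| times
   |z|^x * sum_b |a x b|, and the polynomial factor is absorbed by comparing with
   the double series at two points of U of moduli smaller and larger than |z|. *)

Require Import Defs.
From HB Require Import structures.
From mathcomp Require Import all_boot all_order all_algebra complex.
From mathcomp Require Import all_classical all_reals all_analysis.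
From mathcomp Require Import ring lra.

Import Order.TTheory GRing.Theory Num.Theory.
Import numFieldNormedType.Exports.
Import ComplexField.Normc.

Local Open Scope classical_set_scope.
Local Open Scope complex_scope.
Local Open Scope ring_scope.

Set Implicit Arguments.
Unset Strict Implicit.
Unset Printing Implicit Defensive.

(** * Absolute summability: finite sums, domination, pairs with a finite index *)

Section Summability.
Context {R : realType} {I : choiceType}.
Implicit Types (D : set I) (f g : I -> R).

Lemma summable_sum D n (h : 'I_n -> I -> R) :
  (forall j, summable D (EFin \o h j)) ->
  summable D (fun i => (\sum_(j < n) h j i)%:E).
Proof.
elim: n h => [|n IHn] h hs.
  rewrite /summable esum1 ?ltry// => i _.
  by rewrite big_ord0 abse0.
have := summableD (IHn (fun j => h (widen_ord (leqnSn n) j)) (fun j => hs _))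
  (hs ord_max).
by congr (is_true (summable _ _)); apply/funext => i /=; rewrite big_ord_recr.
Qed.

Lemma summable_dominated D (C : R) f g :
  (forall i, D i -> `|f i| <= C * `|g i|) ->
  summable D (EFin \o g) -> summable D (EFin \o f).
Proof.
move=> fg gs.
(* Rounding [C] up to a natural number turns the bound into a sum of [n] copies of [g]. *)
have [n Cn] : exists n : nat, C <= n%:R.
  by exists (Num.truncn C).+1; apply/ltW/truncnS_gt.
have := @summable_sum D n (fun=> g) (fun=> gs).
apply: le_lt_trans; apply: le_esum => i Di /=.
rewrite lee_fin sumr_const card_ord normrMn (le_trans (fg _ Di))//.
by rewrite -mulr_natl ler_wpM2r.
Qed.

(** Tonelli for nonnegative terms turns the sum over pairs into a finite sum of sums over [D], which
    is finite exactly when each of them is. *)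
Lemma summable_prod_ord D n (h : I * 'I_n -> R) :
  summable (D `*` [set: 'I_n]) (EFin \o h) <->
  forall b, summable D (fun i => (h (i, b))%:E).
Proof.
have E : (\esum_(p in D `*` [set: 'I_n]) `|(h p)%:E| =
    \sum_(b < n) \esum_(i in D) `|(h (i, b))%:E|)%E.
  rewrite -esum_sum//.
  transitivity (\esum_(i in D) \esum_(b in [set: 'I_n]) `|(h (i, b))%:E|)%E.
    by rewrite esum_esum//; apply: eq_esum => -[].
  apply: eq_esum => i _; rewrite esum_fset//; last exact: finite_finset.
  have -> : [set: 'I_n] = [set` xpredT] by apply/seteqP; split.
  by rewrite -(@bigfs _ _ _ _ (index_enum 'I_n)) ?index_enum_uniq// => b;
    rewrite mem_index_enum.
rewrite /summable E; split => [hs b|hs]; last exact: lte_sum_pinfty.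
apply: le_lt_trans hs; rewrite (bigD1 b)//= leeDl// sume_ge0// => j _.
exact: esum_ge0.
Qed.

End Summability.

(** * Modulus, logarithm, and choice of nearby points *)

Section ComplexLog.
Context {R : realType}.
Implicit Types (z w : R[i]) (x r e : R).

Lemma normc_ge0 z : 0 <= normc z.
Proof. by case: z => u v; exact: sqrtr_ge0. Qed.

Lemma normc_gt0 z : z != 0 -> 0 < normc z.
Proof.
move=> z0; rewrite lt_neqAle normc_ge0 andbT eq_sym.
by apply: contra z0 => /eqP /eq0_normc ->.
Qed.

Lemma normc_real x : normc x%:C = `|x|.
Proof. by rewrite /normc /= expr0n /= addr0 sqrtr_sqr. Qed.

Lemma normcX z n : normc (z ^+ n) = normc z ^+ n.
Proof. by elim: n => [|n IHn]; rewrite ?normc1// !exprS normcM IHn. Qed.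

Lemma ler_normc_sum n (F : 'I_n -> R[i]) :
  normc (\sum_(j < n) F j) <= \sum_(j < n) normc (F j).
Proof.
elim/big_ind2: _ => [|z1 x1 z2 x2 h1 h2|//]; first by rewrite normc0.
by apply: le_trans (lerD h1 h2); exact: le_normcD.
Qed.

Lemma normc_cpow z x : normc (cpow z x) = expR (x * ln (normc z)).
Proof.
rewrite /cpow /cexp /normc /clog /real_complex_def; simpc => /=.
rewrite !exprMn -mulrDr cos2Dsin2 mulr1 sqrtr_sqr ger0_norm ?expR_ge0//.
Qed.

(** Modulus and argument determine a nonzero number. This keeps the interpolation nodes [clog (w j)]
    distinct. *)
Lemma clog_inj z w : z != 0 -> w != 0 -> clog z = clog w -> z = w.
Proof.
move=> z0 w0; rewrite /clog => -[lnzw argzw].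
have [_ ->] := carg_def z0; have [_ ->] := carg_def w0.
by rewrite argzw (ln_inj _ _ lnzw)// posrE normc_gt0.
Qed.

Lemma clog_neq0 z : z != 0 -> normc z != 1 -> clog z != 0.
Proof.
move=> z0; apply: contra => /eqP; rewrite /clog => -[ln0 _].
by rewrite -ln_eq0 ?ln0// normc_gt0.
Qed.

Lemma open_normc_ball (U : set R[i]^o) z : open U -> U z ->
  exists2 e : R, 0 < e & forall w, normc (w - z) < e -> U w.
Proof.
move=> oU Uz; have /nbhs_ballP[[e e'] /= e0 zeU] : nbhs (z : R[i]^o) U.
  exact: open_nbhs_nbhs.
(* The radius is an element of [R[i]]; positivity in the order of [R[i]] forces its imaginary part
   to vanish. *)
move: e0; rewrite ltcE /= => /andP[/eqP e'0 e0]; exists e => // w wz.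
apply: zeU; rewrite /ball /= ltcE /= e'0 eqxx /=.
by rewrite -normcN opprB in wz.
Qed.

Lemma interval_avoid x r e : r < e -> exists s, [/\ r < s, s < e & s != x].
Proof.
move=> re; have [xE|xE] := eqVneq ((r + e) / 2) x.
  exists ((r + x) / 2); split; [lra|lra|].
  by apply/eqP => h; lra.
by exists ((r + e) / 2); split => //; lra.
Qed.

(* The excluded radius 1 is the one on which log may vanish. *)
Lemma radial_point z r e : z != 0 -> 0 <= r -> r < e ->
  exists w, [/\ r < normc w, normc w < e, clog w != 0 &
    normc (w - z) = `|normc w - normc z|].
Proof.
move=> z0 r0 /(interval_avoid 1)[s [rs se s1]].
have nz := normc_gt0 z0; have s0 := le_lt_trans r0 rs.
have wE : normc (z * (s / normc z)%:C) = s.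
  rewrite normcM normc_real ger0_norm ?divr_ge0 ?ltW//.
  by rewrite mulrC divfK// gt_eqF.
exists (z * (s / normc z)%:C); rewrite wE; split=> //.
  rewrite clog_neq0 ?wE// mulf_neq0//; apply/eqP => -[] /eqP.
  by rewrite mulf_eq0 invr_eq0 !gt_eqF.
have -> : z * (s / normc z)%:C - z = z * (s / normc z - 1)%:C.
  by rewrite rmorphB /= mulrBr mulr1.
by rewrite normcM normc_real -{1}(gtr0_norm nz) -normrM mulrBr mulr1 mulrCA divff ?mulr1// gt_eqF.
Qed.

(* The rational parametrization (1 + i t) / (1 - i t) of the circle makes
   injectivity and the estimate of w j - z purely algebraic. *)
Lemma circle_points z n e : z != 0 -> 0 < e ->
  exists w : 'I_n -> R[i], [/\ injective w, forall j, normc (w j) = normc z &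
    forall j, normc (w j - z) < e].
Proof.
move=> z0 e0; have nz := normc_gt0 z0.
(* With t = j tau, |w j - z| <= 2 |z| t = e j / (2 (n + 1)), which is below e for every j < n. *)
pose tau : R := e / (4 * normc z * n.+1%:R).
have tau0 : 0 < tau by rewrite divr_gt0// !mulr_gt0.
pose den (t : R) : R[i] := 1 +i* (- t).
pose num (t : R) : R[i] := 1 +i* t.
have den0 t : den t != 0.
  by apply/eqP => -[] /eqP; rewrite oner_eq0.
have normnum t : normc (num t) = normc (den t) by rewrite /normc /= sqrrN.
exists (fun j => z * (num (j%:R * tau) / den (j%:R * tau))); split.
- move=> j k /(mulfI z0) /eqP; rewrite eqr_div// => /eqP.
  rewrite /num /den; simpc => -[_ E].
  have {}E : j%:R * tau = k%:R * tau by lra.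
  by move/(mulIf (lt0r_neq0 tau0))/eqP: E; rewrite eqr_nat => /eqP /val_inj.
- by move=> j; rewrite !normcM normcV normnum divff ?mulr1// gt_eqF// normc_gt0.
- move=> j; set t := j%:R * tau.
  have -> : z * (num t / den t) - z = z * ((num t - den t) / den t).
    by rewrite mulrBl divff// mulrBr mulr1.
  rewrite !normcM normcV.
  have t0 : 0 <= t by rewrite mulr_ge0// ltW.
  have -> : normc (num t - den t) = 2 * t.
    rewrite /num /den /normc; simpc => /=.
    rewrite expr0n /= add0r sqrtr_sqr ger0_norm; lra.
  have den1 : 1 <= normc (den t).
    by rewrite /normc /= -[leLHS]sqrtr1 ler_wsqrtr// expr1n lerDl sqr_ge0.
  have : (normc (den t))^-1 <= 1 by rewrite invf_le1// (lt_le_trans ltr01).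
  move=> /(ler_wpM2l (mulr_ge0 (ler0n R 2) t0)); rewrite mulr1 => /(ler_wpM2l (normc_ge0 z)) /le_lt_trans; apply.
  have -> : normc z * (2 * t) = e * (j%:R / (2 * n.+1%:R)).
    by rewrite /t /tau; field; rewrite !gt_eqF// ltr_wpDr.
  rewrite gtr_pMr// ltr_pdivrMr ?mulr_gt0// mul1r -natrM ltr_nat.
  by rewrite mul2n -addnn ltn_addr// (ltn_trans (ltn_ord j)).
Qed.

End ComplexLog.

(** * Growth in the exponent of the terms and their derivatives, at a fixed point *)

Section DerivativeGrowth.
Context {R : realType}.
Implicit Types (z : R[i]) (x : R) (g : R -> R) (e : R -> expr R).

(* Bounds up to polynomial factors are stable under [ederiv], which creates
   coefficients polynomial in the exponent x. *)
Definition poly_dominated z e g : Prop :=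
  exists C m, 0 <= C /\
    forall x, normc (eeval (e x) z) <= C * (1 + `|x|) ^+ m * g x.

(** All orders up to [k] are controlled together because the product rule mixes lower derivatives of
    both factors. *)
Definition derivs_dominated z k e g : Prop :=
  forall j, (j <= k)%N -> poly_dominated z (fun x => iter j (@ederiv R) (e x)) g.

Lemma one_le_weight m x : 1 <= (1 + `|x|) ^+ m.
Proof. by rewrite exprn_ege1// lerDl. Qed.

Lemma poly_dominatedD z e1 e2 g : (forall x, 0 <= g x) ->
  poly_dominated z e1 g -> poly_dominated z e2 g ->
  poly_dominated z (fun x => EAdd (e1 x) (e2 x)) g.
Proof.
move=> g0 [C1 [m1 [C10 h1]]] [C2 [m2 [C20 h2]]].
exists (C1 + C2), (m1 + m2)%N; split; first exact: addr_ge0.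
move=> x /=; apply: le_trans (le_normcD _ _) _.
rewrite mulrDl mulrDl lerD//.
  apply: (le_trans (h1 x)); rewrite ler_wpM2r// ler_wpM2l// exprD.
  by rewrite ler_peMr ?one_le_weight// exprn_ge0// addr_ge0.
apply: (le_trans (h2 x)); rewrite ler_wpM2r// ler_wpM2l// exprD.
by rewrite ler_peMl ?one_le_weight// exprn_ge0// addr_ge0.
Qed.

Lemma poly_dominatedM z e1 e2 g1 g2 :
  poly_dominated z e1 g1 -> poly_dominated z e2 g2 ->
  poly_dominated z (fun x => EMul (e1 x) (e2 x)) (fun x => g1 x * g2 x).
Proof.
move=> [C1 [m1 [C10 h1]]] [C2 [m2 [C20 h2]]].
exists (C1 * C2), (m1 + m2)%N; split; first exact: mulr_ge0.
move=> x /=; rewrite normcM exprD.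
have := ler_pM (normc_ge0 _) (normc_ge0 _) (h1 x) (h2 x).
by rewrite [leRHS]mulrACA [_ * _ * (C2 * _)]mulrACA.
Qed.

Lemma derivs_dominatedS z k e g : derivs_dominated z k.+1 e g <->
  poly_dominated z e g /\ derivs_dominated z k (fun x => ederiv (e x)) g.
Proof.
split=> [h|[h0 h] [|j] jk]; last 2 first.
- exact: h0.
- by have := h j jk; congr poly_dominated; apply/funext => x; rewrite iterSr.
split=> [|j jk]; first exact: (h 0%N).
by have := h j.+1 jk; congr poly_dominated; apply/funext => x; rewrite iterSr.
Qed.

Lemma derivs_dominatedW z k e g :
  derivs_dominated z k.+1 e g -> derivs_dominated z k e g.
Proof. by move=> h j jk; apply: h; exact: leqW. Qed.

Lemma derivs_dominatedD z k e1 e2 g : (forall x, 0 <= g x) ->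
  derivs_dominated z k e1 g -> derivs_dominated z k e2 g ->
  derivs_dominated z k (fun x => EAdd (e1 x) (e2 x)) g.
Proof.
move=> g0 h1 h2 j jk.
have := poly_dominatedD g0 (h1 j jk) (h2 j jk).
congr poly_dominated; apply/funext => x.
by elim: j {jk} => //= j <-.
Qed.

(** Induction on [k] replaces the Leibniz formula: the derivative is a sum of two products whose
    factors are all controlled to one order less. *)
Lemma derivs_dominatedM z k e1 e2 g1 g2 :
  (forall x, 0 <= g1 x) -> (forall x, 0 <= g2 x) ->
  derivs_dominated z k e1 g1 -> derivs_dominated z k e2 g2 ->
  derivs_dominated z k (fun x => EMul (e1 x) (e2 x)) (fun x => g1 x * g2 x).
Proof.
move=> g10 g20; elim: k e1 e2 => [|k IHk] e1 e2 h1 h2.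
  by move=> [|//] _; apply: poly_dominatedM; [exact: (h1 0%N)|exact: (h2 0%N)].
have /derivs_dominatedS[b1 d1] := h1; have /derivs_dominatedS[b2 d2] := h2.
apply/derivs_dominatedS; split; first exact: poly_dominatedM.
apply: derivs_dominatedD; first by move=> x; exact: mulr_ge0.
  by apply: IHk => //; exact: derivs_dominatedW.
by apply: IHk => //; exact: derivs_dominatedW.
Qed.

Lemma derivs_dominated_const z k (c : R -> R[i]) g : (forall x, 0 <= g x) ->
  poly_dominated z (fun x => EConst (c x)) g ->
  derivs_dominated z k (fun x => EConst (c x)) g.
Proof.
move=> g0 h [_|j jk]; first exact: h.
exists 0, 0%N; split=> // x; rewrite !mul0r.
have -> : iter j.+1 (@ederiv R) (EConst (c x)) = EConst 0.
  by elim: j {jk} => //= j ->.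
by rewrite -[eeval _ _]/(0 : R[i]) normc0.
Qed.

Lemma derivs_dominated_cst z k (e : expr R) :
  derivs_dominated z k (fun=> e) (fun=> 1).
Proof.
move=> j _; exists (normc (eeval (iter j (@ederiv R) e) z)), 0%N.
by split=> [|x]; rewrite ?normc_ge0// expr0 !mulr1.
Qed.

Lemma poly_dominated_pow z (s : R) :
  poly_dominated z (fun x => EPow (x - s)) (fun x => expR (x * ln (normc z))).
Proof.
exists (expR (- s * ln (normc z))), 0%N; split=> [|x]; first exact: expR_ge0.
by rewrite -[eeval _ _]/(cpow z (x - s)) normc_cpow expr0 mulr1 -expRD -mulrDl addrC.
Qed.

(** The shift [s] makes the induction close: differentiating replaces [s] by [s + 1] and brings down
    the factor [x - s], which costs one power of the weight. *)
Lemma derivs_dominated_pow z k (s : R) :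
  derivs_dominated z k (fun x => EPow (x - s))
    (fun x => expR (x * ln (normc z))).
Proof.
elim: k s => [|k IHk] s.
  by move=> [|//] _; exact: poly_dominated_pow.
apply/derivs_dominatedS; split; first exact: poly_dominated_pow.
have -> : (fun x => expR (x * ln (normc z))) =
    (fun x => 1 * expR (x * ln (normc z))).
  by apply/funext => x; rewrite mul1r.
apply: derivs_dominatedM => [_|x||]; [exact: ler01|exact: expR_ge0| |].
  apply: derivs_dominated_const => [_|]; first exact: ler01.
  exists (1 + `|s|), 1%N; split=> [|x]; first by rewrite addr_ge0.
  rewrite -[eeval _ _]/(x - s)%:C normc_real expr1 mulr1 mulrDl mul1r.
  have := ler_normB x s; have := mulr_ge0 (normr_ge0 s) (normr_ge0 x).
  by rewrite mulrDr mulr1; have := normr_ge0 s; lra.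
have -> : (fun x => EPow (x - s - 1)) = (fun x => EPow (x - (s + 1))).
  by apply/funext => x; rewrite opprD addrA.
exact: IHk.
Qed.

Lemma derivs_dominated_sum z k n (F : 'I_n -> R -> expr R) g :
  (forall x, 0 <= g x) -> (forall b, derivs_dominated z k (F b) g) ->
  derivs_dominated z k
    (fun x => \big[@EAdd R/EConst 0]_(b < n) F b x) g.
Proof.
move=> g0 h; elim: (index_enum _) => [|b s IHs].
  have -> : (fun x => \big[@EAdd R/EConst 0]_(b <- [::]) F b x) =
      (fun=> EConst 0) by apply/funext => x; rewrite big_nil.
  apply: derivs_dominated_const => //; exists 0, 0%N; split=> // x.
  by rewrite !mul0r -[eeval _ _]/(0 : R[i]) normc0.
have -> : (fun x => \big[@EAdd R/EConst 0]_(b <- b :: s) F b x) =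
    (fun x => EAdd (F b x) (\big[@EAdd R/EConst 0]_(b <- s) F b x)).
  by apply/funext => x; rewrite big_cons.
exact: derivs_dominatedD.
Qed.

Lemma derivs_dominated_eterm z k N (a : R -> 'I_N.+1 -> R[i]) :
  derivs_dominated z k (fun x => eterm (a x) x)
    (fun x => (\sum_(b < N.+1) normc (a x b)) * expR (x * ln (normc z))).
Proof.
have G0 x : 0 <= \sum_(b < N.+1) normc (a x b).
  by apply: sumr_ge0 => b _; exact: normc_ge0.
apply: derivs_dominatedM => //.
  apply: derivs_dominated_sum => // b.
  (* The factor 1 bounds the power of log z, whose derivatives at the fixed [z] do not depend on
     [x]. *)
  have -> : (fun x => \sum_(b < N.+1) normc (a x b)) =
      (fun x => (\sum_(b < N.+1) normc (a x b)) * 1).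
    by apply/funext => x; rewrite mulr1.
  apply: derivs_dominatedM => //; last exact: derivs_dominated_cst.
  apply: derivs_dominated_const => //; exists 1, 0%N; split=> // x.
  rewrite expr0 !mul1r (bigD1 b)//= lerDl.
  by apply: sumr_ge0 => c _; exact: normc_ge0.
have := @derivs_dominated_pow z k 0.
by congr derivs_dominated; apply/funext => x; rewrite subr0.
Qed.

(** For s > 0, 1 + t <= (1 + 1/s)(1 + s t) <= (1 + 1/s) exp(s t); take the m-th power. The choice s
    = d / (m + 1) gives s m <= d and also covers m = 0. *)
Lemma weight_le_expR (d : R) m : 0 < d ->
  exists2 C, 0 <= C & forall x, (1 + `|x|) ^+ m <= C * expR (d * `|x|).
Proof.
move=> d0; pose s := d / m.+1%:R.
have s0 : 0 < s by rewrite divr_gt0.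
have C0 : 0 <= 1 + s^-1 by rewrite addr_ge0// invr_ge0 ltW.
exists ((1 + s^-1) ^+ m); first exact: exprn_ge0.
move=> x; have x0 := normr_ge0 x.
apply: (@le_trans _ _ (((1 + s^-1) * expR (s * `|x|)) ^+ m)).
  apply: lerXn2r; rewrite ?nnegrE ?addr_ge0 ?mulr_ge0 ?expR_ge0//.
  apply: le_trans (ler_wpM2l C0 (expR_ge1Dx _)).
  have -> : (1 + s^-1) * (1 + s * `|x|) = 1 + `|x| + (s^-1 + s * `|x|).
    by field; rewrite gt_eqF.
  by rewrite lerDl addr_ge0 ?mulr_ge0 ?invr_ge0// ltW.
rewrite exprMn ler_wpM2l ?exprn_ge0//.
rewrite -expRM_natl ler_expR mulrA ler_wpM2r//.
by rewrite /s mulrCA ger_pMr// ler_pdivrMr// mul1r ler_nat.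
Qed.

(** Moving [q] to [r] gains the exponential when x >= 0, and moving it to [p] does when x < 0. It is
    applied to the logarithms of three moduli. *)
Lemma expR_between (x p q r d : R) : d <= q - p -> d <= r - q ->
  expR (d * `|x|) * expR (x * q) <= expR (x * p) + expR (x * r).
Proof.
move=> dp dr; rewrite -expRD; case: (leP 0 x) => x0.
  rewrite ger0_norm//; apply: ler_wpDl; first exact: expR_ge0.
  by rewrite ler_expR; have := ler_wpM2r x0 dr; lra.
rewrite ltr0_norm//; apply: ler_wpDr; first exact: expR_ge0.
by rewrite ler_expR; have := ler_wnM2r (ltW x0) dp; lra.
Qed.

End DerivativeGrowth.

(** * Passing between coefficients, the double series and the derivatives *)

Section DoubleSeries.
Context {R : realType} {N : nat}.
Implicit Types (D : set R) (a : R -> 'I_N.+1 -> R[i]) (z : R[i]).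

(** The values of a polynomial at distinct nodes are its coefficient row times an invertible
    Vandermonde matrix. Summing all entries of the inverse gives a [K] uniform in [c]. *)
Lemma coef_le_values (l : 'I_N.+1 -> R[i]) : injective l ->
  exists K : R, forall c b,
    normc (c b) <= K * \sum_j normc (\sum_(b < N.+1) c b * l j ^+ b).
Proof.
move=> linj; pose V := Vandermonde N.+1 (\row_j l j).
have Vu : V \in unitmx.
  rewrite unitmxE det_Vandermonde unitfE.
  apply/prodf_neq0 => j _; apply/prodf_neq0 => k jk.
  rewrite !mxE subr_eq0; apply/eqP => /linj kj.
  by rewrite kj ltnn in jk.
exists (\sum_b \sum_j normc (invmx V j b)) => c b.
have -> : c b = \sum_j (\sum_(b < N.+1) c b * l j ^+ b) * invmx V j b.
  have := mulmxK Vu (\row_b c b) => /matrixP/(_ ord0 b).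
  rewrite !mxE => <-; apply: eq_bigr => j _; rewrite !mxE; congr (_ * _).
  by apply: eq_bigr => k _; rewrite !mxE.
apply: le_trans (ler_normc_sum _) _; rewrite mulr_sumr; apply: ler_sum => j _.
rewrite normcM mulrC ler_wpM2r ?normc_ge0//.
rewrite (bigD1 b)//= (bigD1 j)//= -addrA lerDl addr_ge0//.
  by apply: sumr_ge0 => k _; exact: normc_ge0.
by apply: sumr_ge0 => k _; apply: sumr_ge0 => i _; exact: normc_ge0.
Qed.

(** The coefficient is recovered by dividing by |log z|^b, hence the nonvanishing of the
    logarithm. *)
Lemma summable_coef D a z b : clog z != 0 ->
  abs_convergent (D `*` [set: 'I_N.+1])
    (fun p : R * 'I_N.+1 => a p.1 p.2 * cpow z p.1 * clog z ^+ p.2) ->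
  summable D (fun x => (normc (a x b) * expR (x * ln (normc z)))%:E).
Proof.
move=> l0 /summable_prod_ord/(_ b).
apply: (@summable_dominated _ _ _ ((normc (clog z) ^+ b)^-1)) => x _.
rewrite !normcM normcX normc_cpow !ger0_norm ?mulr_ge0 ?exprn_ge0 ?normc_ge0 ?expR_ge0//.
by rewrite [leRHS]mulrC mulfK// expf_neq0// gt_eqF// normc_gt0.
Qed.

Lemma abs_convergent_double D a z :
  (forall b, summable D (fun x => (normc (a x b) * expR (x * ln (normc z)))%:E)) ->
  abs_convergent (D `*` [set: 'I_N.+1])
    (fun p : R * 'I_N.+1 => a p.1 p.2 * cpow z p.1 * clog z ^+ p.2).
Proof.
move=> h; apply/summable_prod_ord => b; move: (h b).
apply: (@summable_dominated _ _ _ (normc (clog z) ^+ b)) => x _.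
rewrite !normcM normcX normc_cpow !ger0_norm ?mulr_ge0 ?exprn_ge0 ?normc_ge0 ?expR_ge0//.
by rewrite [leRHS]mulrC.
Qed.

Lemma abs_convergent_deriv D a z w1 w2 k : 0 < normc w1 ->
  normc w1 < normc z -> normc z < normc w2 -> clog w1 != 0 -> clog w2 != 0 ->
  (forall w, w = w1 \/ w = w2 -> abs_convergent (D `*` [set: 'I_N.+1])
    (fun p : R * 'I_N.+1 => a p.1 p.2 * cpow w p.1 * clog w ^+ p.2)) ->
  abs_convergent D
    (fun x => eeval (iter k (@ederiv R) (eterm (a x) x)) z).
Proof.
move=> w10 w1z zw2 l1 l2 conv; pose G x := \sum_(b < N.+1) normc (a x b).
have G0 x : 0 <= G x by apply: sumr_ge0 => b _; exact: normc_ge0.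
have sG w : w = w1 \/ w = w2 ->
    summable D (fun x => (G x * expR (x * ln (normc w)))%:E).
  move=> wE; have lw : clog w != 0 by case: wE => ->.
  have := summable_sum (fun b => summable_coef b lw (conv w wE)).
  by congr (is_true (summable _ _)); apply/funext => x /=; rewrite mulr_suml.
have [C [m [C0 hC]]] := derivs_dominated_eterm z a (leqnn k).
(* The smaller gap between log-moduli is the exponential rate available to absorb the polynomial
   weight on either side. *)
pose d := Num.min (ln (normc z) - ln (normc w1)) (ln (normc w2) - ln (normc z)).
have z0 := lt_trans w10 w1z; have w20 := lt_trans z0 zw2.
have d0 : 0 < d by rewrite lt_min !subr_gt0 !ltr_ln ?posrE// w1z zw2.
have [K K0 hK] := weight_le_expR m d0.
have := summableD (sG w1 (or_introl erefl)) (sG w2 (or_intror erefl)).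
apply: (@summable_dominated _ _ _ (C * K) _
  (fun x => G x * expR (x * ln (normc w1)) + G x * expR (x * ln (normc w2)))) => x _.
rewrite -mulrDr !ger0_norm ?normc_ge0 ?mulr_ge0 ?addr_ge0 ?expR_ge0//.
apply: le_trans (hC x) _; rewrite -!mulrA ler_wpM2l//.
rewrite mulrCA [leRHS]mulrCA (ler_wpM2l (G0 x))//.
have := @expR_between _ x (ln (normc w1)) (ln (normc z)) (ln (normc w2)) d.
rewrite {1 2}/d !ge_min !lexx orbT => /(_ isT isT)/(ler_wpM2l K0).
apply: le_trans.
by rewrite mulrA ler_wpM2r// expR_ge0.
Qed.

End DoubleSeries.

Theorem corollary7p10 (R : realType) (D : set R) (N : nat)
    (a : R -> 'I_N.+1 -> R[i]) (U : set R[i]^o)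
    (openU : open U) (U_neq0 : U !=set0) (U_nz : U `<=` [set z : R[i] | z != 0]) :
  (forall z : R[i], U z ->
     abs_convergent (D `*` [set: 'I_N.+1])
       (fun p : R * 'I_N.+1 => a p.1 p.2 * cpow z p.1 * clog z ^+ p.2))
  <->
  (forall z : R[i], U z ->
     abs_convergent D
       (fun x : R => (\sum_(b < N.+1) a x b * clog z ^+ b) * cpow z x)) /\
  (forall (k : nat) (z : R[i]), U z ->
     abs_convergent D
       (fun x : R => eeval (iter k.+1 (@ederiv R) (eterm (a x) x)) z)).
Proof.
split=> [conv|[conv _] z Uz].
  (* Order 0 is included, so the grouped series itself is the case k = 0. *)
  have derivs k z : U z -> abs_convergent D
      (fun x => eeval (iter k (@ederiv R) (eterm (a x) x)) z).
    move=> Uz; have z0 := U_nz _ Uz; have nz := normc_gt0 z0.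
    have [e e0 eU] := open_normc_ball openU Uz.
    (* The maximum with 0 keeps [w1] away from the origin even when [e] exceeds |z|. *)
    have [w1 [lo1 hi1 l1 d1]] : exists w, [/\ Num.max 0 (normc z - e) < normc w,
        normc w < normc z, clog w != 0 & normc (w - z) = `|normc w - normc z|].
      by apply: radial_point; rewrite ?le_max ?lexx// gt_max nz gtrBl.
    have [w2 [lo2 hi2 l2 d2]] : exists w, [/\ normc z < normc w,
        normc w < normc z + e, clog w != 0 & normc (w - z) = `|normc w - normc z|].
      by apply: radial_point; rewrite ?ltW// ltrDl.
    move: lo1; rewrite gt_max => /andP[w10 lo1].
    apply: (@abs_convergent_deriv _ _ _ _ _ w1 w2) => // w [] ->; apply: conv;
      apply: eU.
      by rewrite d1 ltr_norml; apply/andP; split; lra.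
    by rewrite d2 ltr_norml; apply/andP; split; lra.
  split=> [z Uz|k z]; last exact: derivs.
  have := derivs 0%N z Uz; congr (is_true (summable _ _)); apply/funext => x.
  by rewrite -eeval_eterm.
have z0 := U_nz _ Uz; have [e e0 eU] := open_normc_ball openU Uz.
have [w [winj wz we]] := circle_points N.+1 z0 e0.
have w0 j : w j != 0 by apply: U_nz; exact/eU/we.
have [K hK] : exists K : R, forall c b, normc (c b) <=
    K * \sum_j normc (\sum_(b < N.+1) c b * clog (w j) ^+ b).
  by apply: coef_le_values => j k /(clog_inj (w0 j) (w0 k))/winj.
apply: abs_convergent_double => b.
(* Add the grouped series over the N + 1 nodes: these share the modulus of [z], so the common factor
   |z|^x comes out and interpolation bounds each coefficient. *)
have := summable_sum (fun j => conv _ (eU _ (we j))).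
apply: (summable_dominated (C := K)) => x _.
rewrite !ger0_norm ?mulr_ge0 ?normc_ge0 ?expR_ge0//; last first.
  by apply: sumr_ge0 => j _; exact: normc_ge0.
apply: le_trans (ler_wpM2r (expR_ge0 _) (hK (a x) b)) _.
rewrite -mulrA mulr_suml.
by under [in leRHS]eq_bigr do rewrite normcM normc_cpow wz.
Qed.
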